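(* Let $R$ be either the ring $\mathbb Z[\pi^{-1}]$ for a set $\pi$ of primes, or the ring $\mathbb Z/q$ for some integer $q\ge2$. Let a group $K$ act on a group $H$ by automorphisms. If $H$ and $K$ are residually $\mathcal R_R$ and the action of $K$ on $H^{\mathrm{ab}}\otimes R$ is unipotent, then the semi-direct product $H\rtimes K$ is residually $\mathcal R_R$.
   Context: An $R$-linear action of a group $K$ on an $R$-module $V$ is unipotent if there is a finite filtration by sub-$R$-modules $V=V_1\supseteq V_2\supseteq\cdots\supseteq V_{l+1}=\{0\}$, stable under the action of $K$, such that the induced action of $K$ on each quotient $V_i/V_{i+1}$ is trivial. A filtration $G_*$ on a group $G$ is a sequence of subgroups $G=G_1\supseteq G_2\supseteq\cdots$; it is central if $[G,G_i]\subseteq G_{i+1}$ for all $i$. A $\pi$-number is a positive integer all of whose prime factors lie in $\pi$. A central filtration is $\pi$-free if no non-trivial element of any $G_i/G_{i+1}$ has order a $\pi$-number; it is of $q$-torsion if $g^q\in G_{i+1}$ for all $g\in G_i$ and all $i$. For a group $G$, $\gamma_*^R(G)$ is the smallest $\pi$-free central filtration on $G$ if $R=\mathbb Z[\pi^{-1}]$, and the smallest $q$-torsion central filtration on $G$ if $R=\mathbb Z/q$. $\mathcal R_R$ is the class of groups $G$ such that $\gamma_n^R(G)=1$ for some $n\ge1$. (Concretely: $\mathcal R_R$ is the class of nilpotent groups with no non-trivial element of order a $\pi$-number if $R=\mathbb Z[\pi^{-1}]$, and the class of nilpotent groups whose exponent divides a power of $q$ if $R=\mathbb Z/q$.) A group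 $G$ is residually $\mathcal R$, for a class of groups $\mathcal R$, if for every $g\in G\setminus\{1\}$ there is an epimorphism $\psi\colon G\to Q$ with $Q\in\mathcal R$ and $\psi(g)\neq1$. *)

(* Defs.v *)
From HB Require Import structures.
From mathcomp Require Import all_boot all_order all_algebra.
From mathcomp Require Import boolp classical_sets.
From mathcomp Require Import freeg.

Set Implicit Arguments.
Unset Strict Implicit.
Unset Printing Implicit Defensive.

Import GRing.Theory Num.Theory.

Local Open Scope classical_set_scope.
Local Open Scope quotient_scope.
Local Open Scope ring_scope.

Section Subgroups.
Variable G : groupType.
Implicit Types (A B : set G) (x y g : G).

Definition subgroup A : Prop := group_closed (mem A).

Lemma subgroupP A :
  subgroup A <-> A 1%g /\ (forall x y, A x -> A y -> A (x / y)%g).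
Proof.
split=> -[A1 AF]; split; first by rewrite inE in A1.
- by move=> x y Ax Ay; have := AF x y; rewrite !inE; apply.
- by rewrite inE.
- by move=> x y; rewrite !inE; apply: AF.
Qed.

Lemma subgroup1 A : subgroup A -> A 1%g.
Proof. by case/subgroupP. Qed.

Lemma subgroupV A x : subgroup A -> A x -> A x^-1%g.
Proof.
by case/subgroupP=> A1 AF Ax; have := AF 1%g x A1 Ax; rewrite mul1g.
Qed.

Lemma subgroupM A x y : subgroup A -> A x -> A y -> A (x * y)%g.
Proof.
move=> sA Ax Ay; have /subgroupP[_ AF] := sA.
by rewrite -[y]invgK; apply: AF => //; apply: subgroupV.
Qed.

Definition generated A : set G :=
  [set x | forall B, subgroup B -> A `<=` B -> B x].

Lemma subgroup_generated A : subgroup (generated A).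
Proof.
apply/subgroupP; split=> [B sB _|x y gx gy B sB sAB]; first exact: subgroup1.
by have /subgroupP[_] := sB; apply; [apply: gx|apply: gy].
Qed.

Lemma sub_generated A : A `<=` generated A.
Proof. by move=> x Ax B _; apply. Qed.

Lemma generated_sub A B : subgroup B -> A `<=` B -> generated A `<=` B.
Proof. by move=> sB sAB x; apply. Qed.

Definition commg_subgroup A B : set G :=
  generated [set g | exists2 x, A x & exists2 y, B y & g = [~ x, y]%g].

(* The order of the coset of [g], avoiding a quotient type: [n] is the least
   positive exponent with [g ^+ n] in [A]. *)
Definition order_mod A g (n : nat) : Prop :=
  [/\ (0 < n)%N, A (g ^+ n)%g & forall m, (0 < m < n)%N -> ~ A (g ^+ m)%g].

End Subgroups.

(* The fractions [a / b] with [b] a [pi]-number. *)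
Definition Zinv_pred (pi : nat_pred) : {pred rat} :=
  [pred x : rat | pi.-nat `|denq x|%N].

Section ZinvRing.
Variable pi : nat_pred.

Lemma Zinv_predP (x : rat) (n : nat) (m : int) :
  pi.-nat n -> x * n%:R = m%:~R -> x \in Zinv_pred pi.
Proof.
move=> pin xnm; have n0 : (0 < n)%N by case/andP: pin.
rewrite inE; apply: pnat_dvd pin.
have E : numq x * n%:Z = m * denq x.
  apply: (@intr_inj rat); rewrite !rmorphM /= numqE -xnm /=.
  by rewrite -pmulrn mulrAC.
have : (`|denq x| %| `|numq x| * n)%N.
  by rewrite -[n]/(`|n%:Z|%N) -abszM E abszM dvdn_mull.
by rewrite Gauss_dvdr // coprime_sym coprime_num_den.
Qed.

Lemma Zinv_subring : subring_closed (Zinv_pred pi).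
Proof.
have den (x : rat) : x * `|denq x|%N%:R = (numq x)%:~R.
  by rewrite numqE -[in RHS]absz_denq.
split=> [|x y|x y].
- by apply: (@Zinv_predP _ 1%N 1); rewrite ?mulr1.
- rewrite !inE => px py.
  apply: (@Zinv_predP _ (`|denq x| * `|denq y|)%N
    (numq x * `|denq y|%N%:Z - numq y * `|denq x|%N%:Z)).
    by rewrite pnatM px.
  rewrite rmorphB !rmorphM /= -!den -!pmulrn mulrBl !mulrA.
  by congr (_ - _); rewrite mulrAC.
- rewrite !inE => px py.
  apply: (@Zinv_predP _ (`|denq x| * `|denq y|)%N (numq x * numq y)).
    by rewrite pnatM px.
  by rewrite !rmorphM /= -!den mulrACA.
Qed.

HB.instance Definition _ :=
  GRing.isSubringClosed.Build rat (Zinv_pred pi) Zinv_subring.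

Definition Zinv : Type := {x : rat | x \in Zinv_pred pi}.

HB.instance Definition _ := SubChoice.on Zinv.
HB.instance Definition _ := [SubChoice_isSubComNzRing of Zinv by <:].

End ZinvRing.

(* The coefficient rings $\mathbb Z[\pi^{-1}]$, for a set [pi] of primes, and
   $\mathbb Z/q$. *)
Inductive coef : Type :=
| CoefZinv (pi : nat_pred) of {in pi, forall p, prime p}
| CoefZmod (q : nat) of (2 <= q)%N.

Definition coef_ring (R : coef) : comNzRingType :=
  match R with
  | CoefZinv pi _ => Zinv pi
  | CoefZmod q _ => 'Z_q
  end.

Coercion coef_ring : coef >-> GRing.ComNzRing.type.

(* Filtrations are indexed from [0] : [F i] is the subgroup usually written
   $G_{i+1}$. *)
Section Filtrations.
Variables (R : coef) (G : groupType).
Implicit Type F : nat -> set G.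

Definition filtration F : Prop :=
  [/\ F 0%N = setT, forall i, subgroup (F i) & forall i, F i.+1 `<=` F i].

Definition central F : Prop :=
  forall i, commg_subgroup setT (F i) `<=` F i.+1.

Definition pi_free (pi : nat_pred) F : Prop :=
  forall i g n, F i g -> order_mod (F i.+1) g n -> pi.-nat n -> F i.+1 g.

Definition of_torsion (q : nat) F : Prop :=
  forall i g, F i g -> F i.+1 (g ^+ q)%g.

Definition R_filtration F : Prop :=
  [/\ filtration F, central F &
      match R with
      | CoefZinv pi _ => pi_free pi F
      | CoefZmod q _ => of_torsion q F
      end].

Definition gammaR (i : nat) : set G :=
  [set g | forall F, R_filtration F -> F i g].

Definition classR : Prop := exists i, gammaR i = [set 1%g].

End Filtrations.

Lemma order_mod_dvd (G : groupType) (A : set G) g n m :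
  subgroup A -> order_mod A g n -> A (g ^+ m)%g -> (n %| m)%N.
Proof.
move=> sA [n0 An minn] Am; apply/negPn/negP=> mn0.
apply: (minn (m %% n)%N); first by rewrite lt0n mn0 ltn_mod.
have AX k : A (g ^+ (k * n))%g.
  elim: k => [|k IHk]; first exact: subgroup1.
  by rewrite mulSn expgnDr; apply: subgroupM.
have := Am; rewrite {1}(divn_eq m n) expgnDr => Ad.
rewrite -[X in A X](mulKg (g ^+ (m %/ n * n))%g).
by apply: subgroupM => //; apply: subgroupV.
Qed.

Lemma gammaR_filtration (R : coef) (G : groupType) :
  R_filtration R (@gammaR R G).
Proof.
have sG i : subgroup (@gammaR R G i).
  apply/subgroupP; split=> [F [[_ sF _] _ _]|x y gx gy F RF].
    exact: subgroup1.
  have [[_ sF _] _ _] := RF.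
  by have /subgroupP[_] := sF i; apply; [apply: gx|apply: gy].
split; first split=> //.
- by apply/seteqP; split=> // g _ F [[-> _ _] _ _].
- move=> i g gg F RF; have [[_ _ dF] _ _] := RF.
  by apply: (dF i); apply: gg.
- move=> i; apply: generated_sub => // g [x _ [y gy ->]] F RF.
  have [_ cF _] := RF; apply: (cF i); apply: sub_generated.
  by exists x => //; exists y => //; apply: gy.
- clear sG; case: R => [pi pi_prime|q q_ge2] /=.
  + move=> i g n gg gn pin F [fF cF /= pF].
    have [n0 Gn _] := gn.
    have {}Gn : F i.+1 (g ^+ n)%g by apply: Gn.
    have [_ sF _] := fF.
    have Fg : F i g by apply: gg.
    have exn : exists k, (0 < k)%N && `[< F i.+1 (g ^+ k)%g >].
      by exists n; rewrite n0; apply/asboolP.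
    have [k /andP[k0 /asboolP Fk] mink] := find_ex_minn exn.
    have ok : order_mod (F i.+1) g k.
      split=> // m /andP[m0 mk] Fm.
      have : (k <= m)%N by apply: mink; rewrite m0; apply/asboolP.
      by rewrite leqNgt mk.
    apply: (pF i g k) => //; apply: pnat_dvd pin.
    exact: order_mod_dvd ok Gn.
  + by move=> i g gg F RF; have [_ _] := RF; apply; apply: gg.
Qed.

Lemma gammaR_smallest (R : coef) (G : groupType) (F : nat -> set G) :
  R_filtration R F -> forall i, gammaR R i `<=` F i.
Proof. by move=> RF i g; apply. Qed.

Definition residually (C : groupType -> Prop) (G : groupType) : Prop :=
  forall g : G, g <> 1%g ->
  exists (Q : groupType) (psi : {multiplicative G -> Q}),
    [/\ C Q, range psi = setT & psi g <> 1%g].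

(* A left action of [K] on the group [H] by automorphisms. *)
Record groupAct (K H : groupType) : Type := GroupAct {
  gact :> K -> H -> H;
  gact1 : forall x, gact 1%g x = x;
  gactMl : forall k l x, gact (k * l)%g x = gact k (gact l x);
  gactM : forall k, {morph gact k : x y / (x * y)%g}
}.

HB.instance Definition _ (K H : groupType) (a : groupAct K H) (k : K) :=
  isMultiplicative.Build H H (a k) (gactM a k).

(* $H \rtimes K$, with $(x, k)(y, l) = (x \cdot {}^k y, k l)$. *)
Definition sdprod (K H : groupType) (a : groupAct K H) : Type := (H * K)%type.

Section SemidirectProduct.
Variables (K H : groupType) (a : groupAct K H).

HB.instance Definition _ := Choice.copy (sdprod a) (H * K)%type.

Definition sdprod_one : sdprod a := (1, 1)%g.
Definition sdprod_mul (u v : sdprod a) : sdprod a :=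
  (u.1 * a u.2 v.1, u.2 * v.2)%g.
Definition sdprod_inv (u : sdprod a) : sdprod a :=
  (a u.2^-1 u.1^-1, u.2^-1)%g.

Lemma gact_one k : a k 1%g = 1%g.
Proof. by apply: (@mulgI _ (a k 1%g)); rewrite -gactM !mulg1. Qed.

Lemma sdprod_mulA : associative sdprod_mul.
Proof. by move=> u v w; congr pair; rewrite /= ?gactM ?gactMl !mulgA. Qed.

Lemma sdprod_mul1 : left_id sdprod_one sdprod_mul.
Proof. by case=> x k; rewrite /sdprod_mul /= gact1 !mul1g. Qed.

Lemma sdprod_mulr1 : right_id sdprod_one sdprod_mul.
Proof. by case=> x k; rewrite /sdprod_mul /= gact_one !mulg1. Qed.

Lemma sdprod_mulV : left_inverse sdprod_one sdprod_inv sdprod_mul.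
Proof.
by case=> x k; rewrite /sdprod_mul /= -gactM !mulVg gact_one.
Qed.

Lemma sdprod_mulVr : right_inverse sdprod_one sdprod_inv sdprod_mul.
Proof.
by case=> x k; rewrite /sdprod_mul /= -gactMl !mulgV gact1 mulgV.
Qed.

HB.instance Definition _ := isGroup.Build (sdprod a)
  sdprod_mulA sdprod_mul1 sdprod_mulr1 sdprod_mulV sdprod_mulVr.

End SemidirectProduct.

Section Abelianization.
Variable G : groupType.

Definition derived_subgroup : set G := commg_subgroup setT setT.

Definition ab_rel (x y : G) : bool := `[< derived_subgroup (x^-1 * y)%g >].

Lemma derived_sub : subgroup derived_subgroup.
Proof. exact: subgroup_generated. Qed.

Lemma derived_commg (x y : G) : derived_subgroup [~ x, y]%g.
Proof. by apply: sub_generated; exists x => //; exists y. Qed.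

Lemma derived_conj (x y : G) :
  derived_subgroup x -> derived_subgroup (x ^ y)%g.
Proof.
move=> dx; rewrite -[(x ^ y)%g](mulKg x^-1%g) invgK mulgA.
rewrite -mulgA; apply: (subgroupM derived_sub) => //.
exact: derived_commg.
Qed.

Lemma ab_rel_equiv : equiv_class_of ab_rel.
Proof.
split=> [x|x y|y x z].
- by apply/asboolP; rewrite mulVg; apply: subgroup1 derived_sub.
- by apply/asboolP/asboolP=> /(subgroupV derived_sub); rewrite invgM invgK.
- move=> /asboolP xy /asboolP yz; apply/asboolP.
  by have := subgroupM derived_sub xy yz; rewrite mulgA mulgK.
Qed.

Canonical ab_equiv := EquivRelPack ab_rel_equiv.
Canonical ab_encModRel := defaultEncModRel ab_rel.

Definition abelianization : Type := {eq_quot ab_rel}.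

HB.instance Definition _ : EqQuotient G ab_rel abelianization :=
  EqQuotient.on abelianization.
HB.instance Definition _ := Choice.on abelianization.

Definition to_ab (x : G) : abelianization := \pi x.

Lemma to_abP (x y : G) :
  to_ab x = to_ab y <-> derived_subgroup (x^-1 * y)%g.
Proof.
rewrite /to_ab; split=> [/eqP|d].
  by rewrite piE => /asboolP.
by apply/eqP; rewrite piE; apply/asboolP.
Qed.

Lemma to_ab_surj (u : abelianization) : exists x, u = to_ab x.
Proof. by exists (repr u); rewrite /to_ab reprK. Qed.

Definition ab_zero : abelianization := to_ab 1%g.
Definition ab_opp (u : abelianization) := to_ab (repr u)^-1%g.
Definition ab_add (u v : abelianization) := to_ab (repr u * repr v)%g.

Lemma repr_to_ab (x : G) : derived_subgroup (x^-1 * repr (to_ab x))%g.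
Proof. by apply/to_abP; rewrite /to_ab reprK. Qed.

Lemma ab_addE (x y : G) : ab_add (to_ab x) (to_ab y) = to_ab (x * y)%g.
Proof.
apply/esym/to_abP.
set x' := repr _; set y' := repr _.
have -> : ((x * y)^-1 * (x' * y') = (x^-1 * x') ^ y * (y^-1 * y'))%g.
  by rewrite /conjg invgM !mulgA mulgK.
by apply: (subgroupM derived_sub); [apply: derived_conj|]; apply: repr_to_ab.
Qed.

Lemma ab_oppE (x : G) : ab_opp (to_ab x) = to_ab x^-1%g.
Proof.
apply/to_abP; rewrite invgK.
have := derived_conj x^-1%g (subgroupV derived_sub (repr_to_ab x)).
rewrite /conjg !invgK invgM invgK => d.
have := subgroupV derived_sub d; rewrite !invgM !invgK !mulgA mulgV mul1g.
move=> {}d; have := derived_conj x d.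
have := derived_conj (repr (to_ab x))^-1%g (repr_to_ab x).
by rewrite /conjg !invgK !mulgA mulgK.
Qed.

Lemma ab_addA : associative ab_add.
Proof.
move=> u v w; have [x ->] := to_ab_surj u; have [y ->] := to_ab_surj v.
by have [z ->] := to_ab_surj w; rewrite !ab_addE mulgA.
Qed.

Lemma ab_addC : commutative ab_add.
Proof.
move=> u v; have [x ->] := to_ab_surj u; have [y ->] := to_ab_surj v.
rewrite !ab_addE; apply/to_abP.
have -> : ((x * y)^-1 * (y * x) = [~ y, x])%g.
  by rewrite /commg /conjg invgM !mulgA.
exact: derived_commg.
Qed.

Lemma ab_add0 : left_id ab_zero ab_add.
Proof. by move=> u; have [x ->] := to_ab_surj u; rewrite ab_addE mul1g. Qed.

Lemma ab_addN : left_inverse ab_zero ab_opp ab_add.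
Proof.
by move=> u; have [x ->] := to_ab_surj u; rewrite ab_oppE ab_addE mulVg.
Qed.

HB.instance Definition _ := GRing.isZmodule.Build abelianization
  ab_addA ab_addC ab_add0 ab_addN.

Lemma to_abM (x y : G) : to_ab (x * y)%g = to_ab x + to_ab y.
Proof. by rewrite -ab_addE. Qed.

End Abelianization.

Section AbelianizationMap.
Variables G H : groupType.

Definition ab_map (f : {multiplicative G -> H}) (u : abelianization G) :
  abelianization H := to_ab (f (repr u)).

Variable f : {multiplicative G -> H}.

Lemma multiplicative1 : f 1%g = 1%g.
Proof. by apply: (@mulgI _ (f 1%g)); rewrite -gmulfM !mulg1. Qed.

Lemma multiplicativeV x : f x^-1%g = (f x)^-1%g.
Proof.
by apply: (@mulgI _ (f x)); rewrite -gmulfM !mulgV multiplicative1.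
Qed.

Lemma derived_map x : derived_subgroup x -> derived_subgroup (f x).
Proof.
move=> dx.
apply: (dx [set y | derived_subgroup (f y)]).
- apply/subgroupP; split=> [|y z dy dz] /=.
    by rewrite multiplicative1; apply: subgroup1 (@derived_sub H).
  rewrite gmulfM multiplicativeV; apply: (subgroupM (@derived_sub H)) => //.
  exact: (subgroupV (@derived_sub H)).
- move=> _ [y _ [z _ ->]] /=.
  by rewrite /commg /conjg !gmulfM !multiplicativeV; apply: derived_commg.
Qed.

Lemma ab_mapE x : ab_map f (to_ab x) = to_ab (f x).
Proof.
apply/esym/to_abP; rewrite -multiplicativeV -gmulfM.
by apply: derived_map; apply: repr_to_ab.
Qed.

Lemma ab_map_is_zmod_morphism : zmod_morphism (ab_map f).
Proof.
have abD : {morph ab_map f : u v / u + v}.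
  move=> u v; have [x ->] := to_ab_surj u; have [y ->] := to_ab_surj v.
  by rewrite -to_abM !ab_mapE gmulfM to_abM.
move=> u v; apply: (addIr (ab_map f v)).
by rewrite -abD !subrK.
Qed.

HB.instance Definition _ := GRing.isZmodMorphism.Build
  (abelianization G) (abelianization H) (ab_map f) ab_map_is_zmod_morphism.

End AbelianizationMap.

(* The tensor product over the integers, as the free abelian group on
   [A * B] modulo the subgroup generated by the biadditivity relations. *)
Section Tensor.
Variables A B : zmodType.

Definition tensor_relations : set {freeg (A * B)%type / int} :=
  [set r | (exists a a' b, r = << (a + a', b) >> - << (a, b) >> - << (a', b) >>)
        \/ (exists a b b', r = << (a, b + b') >> - << (a, b) >> - << (a, b') >>)].

Definition tensor_ker : {pred {freeg (A * B)%type / int}} :=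
  fun x => `[< forall S : {pred {freeg (A * B)%type / int}},
                 zmod_closed S -> (forall r, tensor_relations r -> r \in S) ->
                 x \in S >].

Lemma tensor_ker_zmod : zmod_closed tensor_ker.
Proof.
split=> [|x y /asboolP kx /asboolP ky].
  by apply/asboolP=> S [S0 _].
apply/asboolP=> S zS rS; have [_ SB] := zS.
by apply: SB; [apply: kx|apply: ky].
Qed.

HB.instance Definition _ := GRing.isZmodClosed.Build
  {freeg (A * B)%type / int} tensor_ker tensor_ker_zmod.

Definition tensor : Type := Quotient.quot tensor_ker.

HB.instance Definition _ := GRing.Zmodule.on tensor.


Definition to_tensor (x : {freeg (A * B)%type / int}) : tensor :=
  \pi_(Quotient.quot tensor_ker) x.

Lemma to_tensor_is_zmod_morphism : zmod_morphism to_tensor.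
Proof. exact: pi_is_zmod_morphism. Qed.

HB.instance Definition _ := GRing.isZmodMorphism.Build
  {freeg (A * B)%type / int} tensor to_tensor to_tensor_is_zmod_morphism.

Lemma to_tensorP x y :
  to_tensor x = to_tensor y <-> x - y \in tensor_ker.
Proof.
by rewrite Quotient.idealrBE; split=> /eqP.
Qed.

Lemma to_tensor_surj t : exists x, t = to_tensor x.
Proof.
by exists (repr (t : Quotient.quot tensor_ker)); rewrite /to_tensor reprK.
Qed.

Definition tens (a : A) (b : B) : tensor := to_tensor << (a, b) >>.

Lemma to_tensor_rel r : tensor_relations r -> to_tensor r = 0.
Proof.
move=> rel; rewrite -(raddf0 to_tensor); apply/to_tensorP; rewrite subr0.
by apply/asboolP=> S _; apply.
Qed.

Lemma tensDl b : {morph tens^~ b : a a' / a + a'}.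
Proof.
move=> a a' /=; rewrite /tens -raddfD; apply/eqP; rewrite -subr_eq0 -raddfB.
rewrite opprD addrA; apply/eqP/to_tensor_rel; left.
by exists a, a', b.
Qed.

Lemma tensDr a : {morph tens a : b b' / b + b'}.
Proof.
move=> b b' /=; rewrite /tens -raddfD; apply/eqP; rewrite -subr_eq0 -raddfB.
rewrite opprD addrA; apply/eqP/to_tensor_rel; right.
by exists a, b, b'.
Qed.

Lemma tensor_ind (P : tensor -> Prop) :
  P 0 -> (forall t u, P t -> P u -> P (t + u)) ->
  (forall t, P t -> P (- t)) -> (forall a b, P (tens a b)) ->
  forall t, P t.
Proof.
move=> P0 PD PN Pt t; have [x ->] := to_tensor_surj t.
rewrite -(freeg_sumE x) raddf_sum /=.
apply: (big_ind (fun u => P u)) => // -[a b] _.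
have PMn n : P (tens a b *+ n).
  by elim: n => [|n IHn]; rewrite ?mulr0n // mulrS; apply: PD.
have -> : to_tensor << coeff (a, b) x *g (a, b) >> = tens a b *~ coeff (a, b) x.
  rewrite /tens -raddfMz; congr to_tensor.
  by rewrite freegU_mulz intz.
by case: (coeff _ _) => n; rewrite ?NegzE ?mulrNz; [|apply: (PN)]; apply: PMn.
Qed.

Section Lift.
Variables (M : zmodType) (beta : A -> B -> M).

Definition tensor_lift (t : tensor) : M :=
  fglift (fun p => beta p.1 p.2 : zmodule M)
    (repr (t : Quotient.quot tensor_ker)).

Hypothesis betaDl : forall b, {morph beta^~ b : a a' / a + a'}.
Hypothesis betaDr : forall a, {morph beta a : b b' / b + b'}.

Let lift : {freeg (A * B)%type / int} -> zmodule M :=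
  fglift (fun p => beta p.1 p.2 : zmodule M).

Let liftU a b : lift << (a, b) >> = beta a b.
Proof. by rewrite /lift liftU scale1r. Qed.

Let liftB : zmod_morphism lift.
Proof. exact: lift_is_additive. Qed.

Let lift_ker x : x \in tensor_ker -> lift x = 0.
Proof.
move=> /asboolP /(_ [pred y | lift y == 0]) H; apply/eqP; apply: H.
- have l0 : lift 0 = 0 by rewrite -(subrr (0 : {freeg _ / int})) liftB subrr.
  split=> [|y z]; rewrite !inE ?l0 // => /eqP ly /eqP lz.
  by rewrite liftB ly lz subrr.
- move=> _ [] [x1 [x2 [x3 ->]]]; rewrite inE !liftB !liftU.
  + by rewrite betaDl -addrA -opprD subrr.
  + by rewrite betaDr -addrA -opprD subrr.
Qed.

Let tensor_lift_to x : tensor_lift (to_tensor x) = lift x.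
Proof.
apply/eqP; rewrite -subr_eq0 -[X in X == _]liftB; apply/eqP/lift_ker.
by apply/to_tensorP; rewrite /to_tensor reprK.
Qed.

Lemma tensor_liftE a b : tensor_lift (tens a b) = beta a b.
Proof. by rewrite tensor_lift_to liftU. Qed.

Lemma tensor_lift_is_zmod_morphism : zmod_morphism tensor_lift.
Proof.
move=> t u; have [x ->] := to_tensor_surj t; have [y ->] := to_tensor_surj u.
by rewrite -raddfB !tensor_lift_to liftB.
Qed.

Lemma tensor_liftD : {morph tensor_lift : t u / t + u}.
Proof.
move=> t u; apply: (addIr (- tensor_lift u)).
by rewrite -tensor_lift_is_zmod_morphism !addrK.
Qed.

End Lift.

Lemma tensor_ext (M : zmodType) (f g : tensor -> M) :
  {morph f : t u / t + u} -> {morph g : t u / t + u} ->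
  (forall a b, f (tens a b) = g (tens a b)) -> f =1 g.
Proof.
move=> fD gD fg.
have f0 : f 0 = 0 by apply: (addrI (f 0)); rewrite -fD !addr0.
have g0 : g 0 = 0 by apply: (addrI (g 0)); rewrite -gD !addr0.
apply: tensor_ind => [|t u ft fu|t ft|//]; first by rewrite f0 g0.
- by rewrite fD gD ft fu.
- apply: (addrI (f t)); rewrite -fD subrr f0 ft -gD subrr g0.
  by [].
Qed.

End Tensor.

Section TensorMap.
Variables (A A' B B' : zmodType).

Definition tensor_map (f : A -> A') (g : B -> B') :
  tensor A B -> tensor A' B' := tensor_lift (fun a b => tens (f a) (g b)).

Variables (f : A -> A') (g : B -> B').
Hypothesis fD : {morph f : x y / x + y}.
Hypothesis gD : {morph g : x y / x + y}.

Let betaDl b : {morph (fun a b => tens (f a) (g b))^~ b : a a' / a + a'}.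
Proof. by move=> a a'; rewrite fD tensDl. Qed.

Let betaDr a : {morph (fun b => tens (f a) (g b)) : b b' / b + b'}.
Proof. by move=> b b'; rewrite gD tensDr. Qed.

Lemma tensor_mapE a b : tensor_map f g (tens a b) = tens (f a) (g b).
Proof. exact: (tensor_liftE betaDl betaDr). Qed.

Lemma tensor_mapD : {morph tensor_map f g : t u / t + u}.
Proof. exact: (tensor_liftD betaDl betaDr). Qed.

End TensorMap.

(* $A \otimes_{\mathbb Z} R$, with [R] acting on the right-hand factor. *)
Section BaseChange.
Variables (A : zmodType) (R : nzRingType).

Definition base_change : Type := tensor A R.

HB.instance Definition _ := GRing.Zmodule.on base_change.

Definition base_change_scale (r : R) : base_change -> base_change :=
  tensor_map (id : A -> A) (fun s : R => r * s).

Let idD : {morph (id : A -> A) : x y / x + y}.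
Proof. by []. Qed.

Lemma base_change_scaleE r a s :
  base_change_scale r (tens a s) = tens a (r * s).
Proof. exact: (tensor_mapE idD (mulrDr r)). Qed.

Lemma base_change_scaleDr r :
  {morph base_change_scale r : t u / t + u}.
Proof. exact: (tensor_mapD idD (mulrDr r)). Qed.

Lemma base_change_scaleA r s t :
  base_change_scale r (base_change_scale s t) = base_change_scale (r * s) t.
Proof.
pose f u := base_change_scale r (base_change_scale s u).
apply: (@tensor_ext A R base_change f (base_change_scale (r * s))) => [x y|x y|a b].
- by rewrite /f !base_change_scaleDr.
- exact: base_change_scaleDr.
- by rewrite /f !base_change_scaleE mulrA.
Qed.

Lemma base_change_scale1 : left_id 1 base_change_scale.
Proof.
apply: (@tensor_ext A R base_change (base_change_scale 1) id) => [x y|x y|a b] //.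
- exact: base_change_scaleDr.
- by rewrite base_change_scaleE mul1r.
Qed.

Lemma base_change_scaleDl t :
  {morph base_change_scale^~ t : r s / r + s}.
Proof.
move=> r s.
pose f u := base_change_scale r u + base_change_scale s u.
apply: (@tensor_ext A R base_change (base_change_scale (r + s)) f) => [x y|x y|a b].
- exact: base_change_scaleDr.
- by rewrite /f !base_change_scaleDr addrACA.
- by rewrite /f !base_change_scaleE mulrDl tensDr.
Qed.

HB.instance Definition _ := GRing.Zmodule_isLmodule.Build R base_change
  base_change_scaleA base_change_scale1 base_change_scaleDr base_change_scaleDl.

Lemma scale_tens (r : R) (a : A) (s : R) :
  r *: (tens a s : base_change) = tens a (r * s).
Proof. exact: base_change_scaleE. Qed.

End BaseChange.

Record linAct (K : groupType) (R : nzRingType) (V : lmodType R) : Type :=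
  LinAct {
    lact :> K -> V -> V;
    lact1 : forall v, lact 1%g v = v;
    lactM : forall k l v, lact (k * l)%g v = lact k (lact l v);
    lact_linear : forall k, linear (lact k)
  }.

(* [W i] is the submodule usually written $V_{i+1}$. *)
Definition unipotent (K : groupType) (R : nzRingType) (V : lmodType R)
    (rho : linAct K V) : Prop :=
  exists (l : nat) (W : nat -> set V),
    [/\ W 0%N = setT, W l = [set 0],
        forall i, (i <= l)%N -> submod_closed (mem (W i)),
        forall i k v, (i <= l)%N -> W i v -> W i (rho k v) &
        forall i, (i < l)%N -> W i.+1 `<=` W i /\
          forall k v, W i v -> W i.+1 (rho k v - v)].

(* $k \cdot (\bar x \otimes r) = \overline{k \cdot x} \otimes r$; see [ab_actE]. *)
Section InducedAction.
Variables (K H : groupType) (a : groupAct K H) (R : nzRingType).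

Definition ab_act (k : K) : base_change (abelianization H) R ->
    base_change (abelianization H) R :=
  tensor_map (ab_map (a k)) (id : R -> R).

Let abD k : {morph ab_map (a k) : x y / x + y}.
Proof. exact: raddfD. Qed.

Let idD : {morph (id : R -> R) : x y / x + y}.
Proof. by []. Qed.

Lemma ab_actE k x r :
  ab_act k (tens (to_ab x) r) = tens (to_ab (a k x)) r.
Proof. by rewrite /ab_act (tensor_mapE (@abD k) idD) ab_mapE. Qed.

Lemma ab_actD k : {morph ab_act k : t u / t + u}.
Proof. exact: (tensor_mapD (@abD k) idD). Qed.

Lemma ab_act1 t : ab_act 1%g t = t.
Proof.
apply: (@tensor_ext _ _ (base_change _ R) (ab_act 1%g) id) => [x y|x y|u r] //.
- exact: ab_actD.
- by have [x ->] := to_ab_surj u; rewrite ab_actE gact1.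
Qed.

Lemma ab_actM k l t : ab_act (k * l)%g t = ab_act k (ab_act l t).
Proof.
pose f u := ab_act k (ab_act l u).
apply: (@tensor_ext _ _ (base_change _ R) (ab_act (k * l)%g) f) => [x y|x y|u r].
- exact: ab_actD.
- by rewrite /f !ab_actD.
- by have [x ->] := to_ab_surj u; rewrite /f !ab_actE gactMl.
Qed.

Lemma ab_act_linear k : linear (ab_act k).
Proof.
move=> r t u; rewrite ab_actD; congr (_ + _).
pose f v : base_change _ R := ab_act k (r *: v).
pose g v : base_change _ R := r *: ab_act k v.
apply: (@tensor_ext _ _ (base_change _ R) f g) => [x y|x y|v s].
- by rewrite /f scalerDr ab_actD.
- by rewrite /g ab_actD scalerDr.
- have [x ->] := to_ab_surj v.
  by rewrite /f /g scale_tens !ab_actE scale_tens.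
Qed.

Definition ab_linAct : linAct K (base_change (abelianization H) R) :=
  LinAct ab_act1 ab_actM ab_act_linear.

End InducedAction.

(* Main.v *)
Require Import Defs.
From mathcomp Require Import all_boot all_order all_algebra.
From mathcomp Require Import boolp classical_sets.
From HB Require Import structures.
From mathcomp Require Import freeg.

(** An element of [H * K] outside [H] survives in [K], which is residually
    $\mathcal R_R$. An element [x] of [H] is, by residuality of [H], outside
    some term [gammaR R n] of the [R]-lower central series of [H]. It then
    suffices to find an [R]-filtration [F] of [H] that [K] contracts, meaning
    that [k(y) y^-1] is in [F i.+1] whenever [y] is in [F i], and some term of
    which is contained in [gammaR R n]. Indeed the elements [k] of [K] that
    move each [F j] into [F (j + i).+1] form an [R]-filtration of [K]
    ([R_filtration_shifting], a three subgroups argument); together the two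
    give an [R]-filtration of the semidirect product ([R_filtration_sdprod]),
    one of whose terms misses [x], and dividing by that term finishes.

    To obtain [F], the lower central series of [H] is refined, by showing that
    [K] acts unipotently on each factor [gammaR R c / gammaR R c.+1]. Inside
    such a factor let [upper c i] be the [i]-th term of the ascending series of
    successive fixed points of [K]; unipotence says that it reaches the whole
    factor. For [c = 0] this is the hypothesis on $H^{ab} \otimes R$, because
    the kernel of $H \to H^{ab} \otimes R$ lies in [gammaR R 1]
    ([tens1_eq0_gammaR]). For the passage from [c] to [c + 1], commutation is
    bilinear modulo [gammaR R c.+2], hence brackets [upper c i] with
    [upper 0 j] into [upper c.+1 (i + j)] ([upper_comm]), and over $\mathbb Z/q$
    the [q]-th powers are controlled in the same way ([upper_pow]). So some
    [upper c.+1 s] contains all the commutators and powers that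
    [gammaR R c.+1] must contain; as it is also closed under the roots that
    $\mathbb Z[\pi^{-1}]$ prescribes ([upper_factor]), putting it in place of
    [gammaR R c.+1] leaves an [R]-filtration, and minimality of [gammaR]
    makes the two equal ([exhausted_step]). *)

Set Implicit Arguments.
Unset Strict Implicit.
Unset Printing Implicit Defensive.

Import GRing.Theory.

Local Open Scope classical_set_scope.
Local Open Scope quotient_scope.
Local Open Scope group_scope.

(** * Quotients of groups *)

Record normal_subgroup (G : groupType) := NormalSubgroup {
  normal_set :> G -> Prop;
  normal_subP : @subgroup G normal_set;
  normal_conj : forall x g, normal_set x -> normal_set (x ^ g)
}.

Section MultiplicativeTheory.
Variables (G H : groupType) (f : {multiplicative G -> H}).

Lemma multiplicativeX n : {morph f : x / x ^+ n}.
Proof.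
move=> x; elim: n => [|n IHn]; first exact: multiplicative1.
by rewrite !expgS gmulfM IHn.
Qed.

Lemma multiplicativeR : {morph f : x y / [~ x, y]}.
Proof. by move=> x y; rewrite /commg /conjg !(gmulfM, multiplicativeV). Qed.

End MultiplicativeTheory.

Section QuotientGroup.
Variables (G : groupType) (N : normal_subgroup G).
Let sN := normal_subP N.

Definition coset_rel (x y : G) : bool := `[< N (x^-1 * y) >].

Lemma coset_rel_equiv : equiv_class_of coset_rel.
Proof.
split=> [x|x y|y x z].
- by apply/asboolP; rewrite mulVg; apply: subgroup1.
- by apply/asboolP/asboolP=> /(subgroupV sN); rewrite invgM invgK.
- move=> /asboolP xy /asboolP yz; apply/asboolP.
  by have := subgroupM sN xy yz; rewrite mulgA mulgK.
Qed.

Canonical coset_equiv := EquivRelPack coset_rel_equiv.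
Canonical coset_encModRel := defaultEncModRel coset_rel.

Definition quotient_group : Type := {eq_quot coset_rel}.

HB.instance Definition _ : EqQuotient G coset_rel quotient_group :=
  EqQuotient.on quotient_group.
HB.instance Definition _ := Choice.on quotient_group.

Definition coset_proj (x : G) : quotient_group := \pi x.

Lemma coset_projP x y : coset_proj x = coset_proj y <-> N (x^-1 * y).
Proof.
rewrite /coset_proj; split=> [/eqP|d].
  by rewrite piE => /asboolP.
by apply/eqP; rewrite piE; apply/asboolP.
Qed.

Lemma coset_proj_surj (u : quotient_group) : exists x, u = coset_proj x.
Proof. by exists (repr u); rewrite /coset_proj reprK. Qed.

Definition coset_mul (u v : quotient_group) := coset_proj (repr u * repr v).
Definition coset_inv (u : quotient_group) := coset_proj (repr u)^-1.

Lemma coset_mulE x y :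
  coset_mul (coset_proj x) (coset_proj y) = coset_proj (x * y).
Proof.
have repN z : N (z^-1 * repr (coset_proj z)).
  by apply/coset_projP; rewrite /coset_proj reprK.
apply/esym/coset_projP.
set x' := repr _; set y' := repr _.
have -> : (x * y)^-1 * (x' * y') = (x^-1 * x') ^ y * (y^-1 * y').
  by rewrite /conjg invgM !mulgA mulgK.
by apply: (subgroupM sN); [apply: normal_conj|]; apply: repN.
Qed.

Lemma coset_mulA : associative coset_mul.
Proof.
move=> u v w; have [x ->] := coset_proj_surj u.
have [y ->] := coset_proj_surj v; have [z ->] := coset_proj_surj w.
by rewrite !coset_mulE mulgA.
Qed.

Lemma coset_mul1 : left_id (coset_proj 1) coset_mul.
Proof.
by move=> u; have [x ->] := coset_proj_surj u; rewrite coset_mulE mul1g.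
Qed.

Lemma coset_mulr1 : right_id (coset_proj 1) coset_mul.
Proof.
by move=> u; have [x ->] := coset_proj_surj u; rewrite coset_mulE mulg1.
Qed.

Lemma coset_mulV : left_inverse (coset_proj 1) coset_inv coset_mul.
Proof.
by move=> u; rewrite -{2}[u]reprK coset_mulE mulVg.
Qed.

Lemma coset_mulVr : right_inverse (coset_proj 1) coset_inv coset_mul.
Proof.
by move=> u; rewrite -{1}[u]reprK coset_mulE mulgV.
Qed.

HB.instance Definition _ := isGroup.Build quotient_group
  coset_mulA coset_mul1 coset_mulr1 coset_mulV coset_mulVr.

Lemma coset_projM : {morph coset_proj : x y / x * y}.
Proof. by move=> x y; rewrite -coset_mulE. Qed.

HB.instance Definition _ :=
  isMultiplicative.Build G quotient_group coset_proj coset_projM.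

Lemma coset_proj1 x : coset_proj x = 1 <-> N x.
Proof.
split=> [/esym/coset_projP|Nx]; first by rewrite invg1 mul1g.
by apply/esym/coset_projP; rewrite invg1 mul1g.
Qed.

End QuotientGroup.
(** Congruence modulo a normal subgroup becomes equality of images, so that
    computations up to [N] can be done by rewriting in [Q]. *)
Lemma exists_quotient (G : groupType) (N : set G) :
  subgroup N -> (forall x g, N x -> N (x ^ g)) ->
  exists (Q : groupType) (p : {multiplicative G -> Q}),
    [/\ range p = setT, forall x, p x = 1 <-> N x &
      forall x y, p x = p y <-> N (x * y^-1)].
Proof.
move=> sN cN; pose N' := NormalSubgroup sN cN.
exists (quotient_group N'), (coset_proj N' : {multiplicative G -> _}).
split; [|exact: coset_proj1|].
  apply/seteqP; split=> // u _.
  by have [x ->] := coset_proj_surj u; exists x.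
move=> x y; apply: iff_trans (coset_proj1 N' _).
rewrite gmulfM multiplicativeV; split=> [->|/divg1_eq//]; exact: mulgV.
Qed.

(** * Filtrations attached to the coefficient ring *)

Section Filtration.
Variables (R : coef) (G : groupType).
Implicit Types (M N : set G) (F : nat -> set G).

(** The condition that the ring [R] puts on a factor [M / N]: no [pi]-torsion,
    or exponent dividing [q]. *)
Definition R_factor M N : Prop :=
  match R with
  | CoefZinv pi _ => forall x n, M x -> pi.-nat n -> N (x ^+ n) -> N x
  | CoefZmod q _ => forall x, M x -> N (x ^+ q)
  end.

Lemma subgroupX N x n : subgroup N -> N x -> N (x ^+ n).
Proof.
move=> sN Nx; elim: n => [|n IHn]; first exact: subgroup1.
by rewrite expgS; apply: subgroupM.
Qed.

(** An element with a [pi]-number power in [N] has an order modulo [N] that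
    divides this number, so that exact orders can be dispensed with. *)
Lemma R_factor_pi_freeP (pi : nat_pred) M N : subgroup N ->
  (forall g n, M g -> order_mod N g n -> pi.-nat n -> N g) <->
  (forall x n, M x -> pi.-nat n -> N (x ^+ n) -> N x).
Proof.
move=> sN; split=> [H x n Mx pin Nxn|H g n Mg [_ Ngn _] pin]; last exact: H Ngn.
have n0 : (0 < n)%N by case/andP: pin.
have exn : exists k, (0 < k)%N && `[< N (x ^+ k) >].
  by exists n; rewrite n0; apply/asboolP.
have [k /andP[k0 /asboolP Nk] mink] := find_ex_minn exn.
have ok : order_mod N x k.
  split=> // m /andP[m0 mk] Nm.
  have : (k <= m)%N by apply: mink; rewrite m0; apply/asboolP.
  by rewrite leqNgt mk.
by apply: (H x k) => //; apply: pnat_dvd pin; apply: order_mod_dvd ok Nxn.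
Qed.

Lemma R_filtrationP F :
  R_filtration R F <->
  [/\ F 0%N = setT, forall i, subgroup (F i), forall i, F i.+1 `<=` F i,
      forall i x y, F i y -> F i.+1 [~ x, y] &
      forall i, R_factor (F i) (F i.+1)].
Proof.
rewrite /R_filtration /R_factor; split.
  move=> [[F0 sF dF] cF RF]; split=> //.
    move=> i x y Fy; apply: (cF i); apply: sub_generated.
    by exists x => //; exists y.
  case: R RF => [pi pr|q q2] RF i /=; last exact: RF.
  by apply/R_factor_pi_freeP => //; apply: RF.
move=> [F0 sF dF cF RF]; split=> //.
  by move=> i; apply: generated_sub => // _ [x _ [y Fy ->]]; apply: cF.
case: R RF => [pi pr|q q2] RF i /=; last exact: RF.
by apply/(R_factor_pi_freeP _ (F i)) => //; apply: RF.
Qed.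

Section Facts.
Variable F : nat -> set G.
Hypothesis FR : R_filtration R F.

Lemma filt0 x : F 0%N x.
Proof. by have /R_filtrationP[-> ] := FR. Qed.

Lemma filt_sub i : subgroup (F i).
Proof. by have /R_filtrationP[] := FR. Qed.

Lemma filt_dec i j : (i <= j)%N -> F j `<=` F i.
Proof.
have /R_filtrationP[_ _ dF _ _] := FR.
move=> /subnK <-; elim: (j - i)%N => [//|n IHn].
by rewrite addSn; apply: subset_trans (dF _) IHn.
Qed.

Lemma filt_comm i x y : F i y -> F i.+1 [~ x, y].
Proof. by have /R_filtrationP[] := FR => _ _ _ + _; apply. Qed.

Lemma filt_comml i x y : F i x -> F i.+1 [~ x, y].
Proof.
by move=> Fx; rewrite -invgR; apply/(subgroupV (filt_sub _))/filt_comm.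
Qed.

Lemma filt_conj i x g : F i x -> F i (x ^ g).
Proof.
move=> Fx; rewrite -[x ^ g](mulVKg x); apply: (subgroupM (filt_sub _) Fx).
exact: filt_dec (leqnSn i) _ (filt_comml _ Fx).
Qed.

Lemma filt_factor i : R_factor (F i) (F i.+1).
Proof. by have /R_filtrationP[] := FR. Qed.

Lemma filt_quotient i : exists (Q : groupType) (p : {multiplicative G -> Q}),
  [/\ range p = setT, forall x, p x = 1 <-> F i x &
      forall x y, p x = p y <-> F i (x * y^-1)].
Proof.
by apply: exists_quotient => [|x g]; [apply: filt_sub|apply: filt_conj].
Qed.

End Facts.
End Filtration.

Lemma R_filtration_preim (R : coef) (G H : groupType)
    (f : {multiplicative G -> H}) (F : nat -> set H) :
  R_filtration R F -> R_filtration R (fun i => f @^-1` F i).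
Proof.
move=> FR; apply/R_filtrationP; split=> [|i|i x|i x y|i] /=.
- by apply/seteqP; split=> // x _ /=; apply: filt0 FR _.
- apply/subgroupP; split=> [|x y Fx Fy] /=.
    by rewrite multiplicative1; apply: subgroup1 (filt_sub FR i).
  rewrite gmulfM multiplicativeV; apply: (subgroupM (filt_sub FR i)) => //.
  exact: subgroupV (filt_sub FR i) _.
- exact: filt_dec FR _ _ (leqnSn i) _.
- by move=> Fy; rewrite multiplicativeR; apply: filt_comm FR _ _ _ Fy.
- have := filt_factor FR i; case: R {FR} => [pi pr|q q2] /= RF x.
    by move=> n Fx pin; rewrite multiplicativeX; apply: RF.
  by rewrite multiplicativeX; apply: RF.
Qed.

Lemma gammaR_map (R : coef) (G H : groupType)
    (f : {multiplicative G -> H}) i x :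
  gammaR R i x -> gammaR R i (f x).
Proof. by move=> gx F FR; apply: (gx _ (R_filtration_preim f FR)). Qed.

(** The images of the [F i] in the quotient by [F n] are an [R]-filtration
    whose term of index [n] is trivial: up to index [n] the factors are those of
    [F], and after that they are trivial. *)
Lemma R_filtration_quotient (R : coef) (G : groupType) (F : nat -> set G) n :
  R_filtration R F -> forall g, ~ F n g ->
  exists (Q : groupType) (psi : {multiplicative G -> Q}),
    [/\ classR R Q, range psi = setT & psi g <> 1].
Proof.
move=> FR g Fng; have [Q [p [pT p1 pE]]] := filt_quotient FR n.
have psurj u : exists x, u = p x.
  by have : setT u by []; rewrite -pT => -[x _ <-]; exists x.
exists Q, p; split=> //; last by move/p1.
exists n; apply/seteqP; split=> [u|_ -> F' F'R]; last first.
  exact: subgroup1 (filt_sub F'R n).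
have QR : R_filtration R (fun i => p @` F i).
  have lift i x : (i < n)%N -> (p @` F i.+1) (p x) -> F i.+1 x.
    move=> ni [y Fy /esym/pE Fxy]; rewrite -[x](divgK y).
    apply: (subgroupM (filt_sub FR _)) => //.
    exact: filt_dec FR _ _ ni _ Fxy.
  have im1 i : (p @` F i) 1.
    by exists 1; [apply: subgroup1 (filt_sub FR i)|apply: multiplicative1].
  apply/R_filtrationP; split=> [|i|i|i v w|i].
  - apply/seteqP; split=> // v _; have [x ->] := psurj v.
    by exists x => //; apply: filt0 FR _.
  - apply/subgroupP; split=> // _ _ [x Fx <-] [y Fy <-].
    exists (x * y^-1); last by rewrite gmulfM multiplicativeV.
    apply: (subgroupM (filt_sub FR i)) => //.
    exact: subgroupV (filt_sub FR i) _.
  - move=> _ [x Fx <-]; exists x => //.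
    exact: filt_dec FR _ _ (leqnSn i) _ Fx.
  - have [x ->] := psurj v; move=> [y Fy <-]; exists [~ x, y].
      exact: filt_comm FR _ _ _ Fy.
    exact: multiplicativeR.
  - case: (leqP n i) => ni.
      have triv v : (p @` F i) v -> v = 1.
        by case=> x Fx <-; apply/p1; apply: filt_dec FR _ _ ni _ Fx.
      clear - triv im1; case: R => [pi pr|q q2] /= v.
        by move=> m /triv->; rewrite expg1n.
      by move=> /triv->; rewrite expg1n; apply: im1.
    have := filt_factor FR i.
    have {}lift x := @lift i x ni; have sF := filt_sub FR i.
    clear - lift sF; case: R => [pi pr|q q2] /= RF.
      move=> _ m [x Fx <-] pim; rewrite -multiplicativeX => Fm.
      by exists x => //; apply: (RF x m) => //; apply: lift.
    by move=> _ [x Fx <-]; exists (x ^+ q); [apply: RF|apply: multiplicativeX].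
move=> /(_ _ QR)[x Fx <-]; exact/p1.
Qed.
(** * Contracting actions *)

Section Contracting.
Variables (R : coef) (K H : groupType) (a : groupAct K H) (F : nat -> set H).
Hypothesis FR : R_filtration R F.

Definition contracts (M N : set H) : Prop :=
  forall k x, M x -> N (a k x * x^-1).

Hypothesis Fa : forall i, contracts (F i) (F i.+1).

Lemma contracts_stable i k x : F i x -> F i (a k x).
Proof.
move=> Fx; rewrite -[a k x](divgK x).
apply: (subgroupM (filt_sub FR i)) => //.
exact: filt_dec FR _ _ (leqnSn i) _ (Fa k Fx).
Qed.

(** The hypothesis [Fa] says that all of [K] has degree at least one; the terms
    of the induced filtration of [K] are the sets of elements of degree at least
    [i.+1]. *)
Definition shifting (i : nat) : set K :=
  [set k | forall j x, F j x -> F (j + i).+1 (a k x * x^-1)].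

Lemma shifting_mod i j k x (Q : groupType) (p : {multiplicative H -> Q}) :
  (forall u v, p u = p v <-> F (j + i).+1 (u * v^-1)) ->
  shifting i k -> F j x -> p (a k x) = p x.
Proof. by move=> pE sk Fx; apply/pE; apply: sk. Qed.

(** If [l] moves [x] to [e * x] and [k] moves [x] to [d * x], then [l k x] and
    [k l x] are [d * e * x] and [e * d * x] up to terms of higher degree, and
    [d] and [e] commute up to such terms: hence centrality. The displacement of
    [x] by [k ^+ n] is [d ^+ n] up to terms of higher degree, so that the
    condition of [R] passes from the factors of [F] to those of [shifting]. *)
Lemma R_filtration_shifting : R_filtration R shifting.
Proof.
have sF := filt_sub FR.
have translate k x : exists d, a k x = d * x.
  by exists (a k x * x^-1); rewrite divgK.
apply/R_filtrationP; split=> [|i|i k|i l k|i].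
- apply/seteqP; split=> // k _ j x Fx /=; rewrite addn0; exact: Fa.
- apply/subgroupP; split=> [j x _|k l sk sl j x Fx].
    by rewrite gact1 mulgV; apply: subgroup1.
  have Flx : F j (a l^-1 x) by apply: contracts_stable.
  have [Q [p [_ p1 pE]]] := filt_quotient FR (j + i).+1.
  apply/pE; rewrite gactMl (shifting_mod pE sk Flx).
  by rewrite -(shifting_mod pE sl Flx) -gactMl mulgV gact1.
- move=> sk j x Fx; apply: filt_dec FR _ _ _ _ (sk j x Fx).
  by rewrite addnS.
- move=> sk j x Fx; rewrite addnS.
  have [e le] := translate l x; have [d kd] := translate k x.
  have Fe : F j.+1 e by have := Fa l Fx; rewrite le mulgK.
  have Fd : F (j + i).+1 d by have := sk j x Fx; rewrite kd mulgK.
  have [Q [p [_ p1 pE]]] := filt_quotient FR (j + i).+2.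
  have pkl : p (a (l * k) x) = p (a (k * l) x).
    have -> : a (l * k) x = a l d * e * x by rewrite gactMl kd gactM le mulgA.
    have -> : a (k * l) x = a k e * d * x by rewrite gactMl le gactM kd mulgA.
    rewrite !gmulfM; congr (_ * _).
    have -> : p (a l d) = p d by apply/pE; apply: Fa.
    have -> : p (a k e) = p e by apply/pE; rewrite -addSn; apply: sk.
    rewrite -!gmulfM; apply/pE.
    have -> : d * e * (e * d)^-1 = [~ d^-1, e^-1].
      by rewrite /commg /conjg invgM !invgK !mulgA.
    by apply: (filt_comml FR); apply: subgroupV.
  have -> : a [~ l, k] x * x^-1 =
      a (k * l)^-1 (a (l * k) x * (a (k * l) x)^-1).
    rewrite gactM -multiplicativeV -!gactMl mulVg gact1; congr (a _ _ * _).
    by rewrite /commg /conjg invgM !mulgA.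
  by apply: contracts_stable; apply/pE.
- have key k j x n : shifting i k -> F j x -> exists d, F (j + i).+1 d /\
      (F (j + i).+2 (a (k ^+ n) x * x^-1) <-> F (j + i).+2 (d ^+ n)) /\
      (F (j + i).+2 (a k x * x^-1) <-> F (j + i).+2 d).
    move=> sk Fx; have [d kd] := translate k x.
    have Fd : F (j + i).+1 d by have := sk j x Fx; rewrite kd mulgK.
    exists d; split=> //; split; last by rewrite kd mulgK.
    have [Q [p [_ p1 pE]]] := filt_quotient FR (j + i).+2.
    have pd : p (a k d) = p d by apply/pE; apply: Fa.
    have pk u v : p u = p v -> p (a k u) = p (a k v).
      by rewrite !pE -multiplicativeV -gactM; apply: contracts_stable.
    have E : p (a (k ^+ n) x) = p (d ^+ n * x).
      elim: n => [|n IHn]; first by rewrite gact1 mul1g.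
      rewrite expgS gactMl (pk _ _ IHn) gactM kd expgSr !gmulfM mulgA.
      by rewrite !multiplicativeX pd.
    by rewrite -!p1 gmulfM E gmulfM multiplicativeV mulgK.
  have := filt_factor FR; case: (R) => [pi pr|q q2] /= RF k.
    move=> n sk pin skn j x Fx; rewrite addnS.
    have [d [Fd [dn ->]]] := key k j x n sk Fx.
    by apply: (RF _ _ n) => //; apply/dn; rewrite -addnS; apply: skn.
  move=> sk j x Fx; rewrite addnS.
  by have [d [Fd [-> _]]] := key k j x q sk Fx; apply: RF.
Qed.

End Contracting.
(** * Filtering the semidirect product *)

Section SdprodFiltration.
Variables (R : coef) (K H : groupType) (a : groupAct K H) (F : nat -> set H).
Hypothesis FR : R_filtration R F.
Hypothesis Fa : forall i, contracts a (F i) (F i.+1).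

Definition sdprod_filtration (i : nat) : set (sdprod a) :=
  [set u | F i u.1 /\ shifting a F i u.2].

Let E := sdprod_filtration.
Let sR := R_filtration_shifting FR Fa.

Lemma sdprod_mulVE (u v : sdprod a) :
  u^-1 * v = (a u.2^-1 (u.1^-1 * v.1), u.2^-1 * v.2) :> sdprod a.
Proof. by rewrite gactM. Qed.

Lemma subgroup_sdprod_filtration i : subgroup (E i).
Proof.
apply/subgroupP; split=> [|u v [Fu su] [Fv sv]]; split.
- exact: subgroup1 (filt_sub FR i).
- exact: subgroup1 (filt_sub sR i).
- apply: (subgroupM (filt_sub FR i)) => //.
  do 2!apply: (contracts_stable FR Fa); exact: subgroupV (filt_sub FR i) Fv.
- apply: (subgroupM (filt_sub sR i)) => //.
  exact: subgroupV (filt_sub sR i) _.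
Qed.

(** As [u.2] moves the elements of [F i] only by elements of [F i.+1], the twist
    disappears from powers modulo [F i.+1]. *)
Lemma sdprod_filtrationX i u n : E i u ->
  (u ^+ n).2 = u.2 ^+ n /\ (F i.+1 (u ^+ n).1 <-> F i.+1 (u.1 ^+ n)).
Proof.
move=> Eu; have [Q [p [_ p1 pE]]] := filt_quotient FR i.+1.
rewrite -!p1 multiplicativeX.
suff [E2 E1] : (u ^+ n).2 = u.2 ^+ n /\ p (u ^+ n).1 = p u.1 ^+ n.
  by rewrite E1; split.
elim: n => [|n [IH2 IH1]]; first by split=> //; apply: multiplicative1.
rewrite !expgS -IH2 -IH1; split=> //=; rewrite gmulfM; congr (_ * _).
apply/pE; apply: Fa.
by have [] := subgroupX n (subgroup_sdprod_filtration i) Eu.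
Qed.

Lemma R_filtration_sdprod : R_filtration R E.
Proof.
apply/R_filtrationP; split=> [|i|i|i u v|i].
- by apply/seteqP; split=> // u _; split; [apply: filt0 FR _|apply: filt0 sR _].
- exact: subgroup_sdprod_filtration.
- move=> u [Fu su]; split; first exact: filt_dec FR _ _ (leqnSn i) _ Fu.
  exact: filt_dec sR _ _ (leqnSn i) _ su.
- move=> [Fv sv].
  have -> : [~ u, v] = (v * u)^-1 * (u * v).
    by rewrite /commg /conjg invgM !mulgA.
  rewrite sdprod_mulVE; split=> /=; last first.
    have -> : (v.2 * u.2)^-1 * (u.2 * v.2) = [~ u.2, v.2].
      by rewrite /commg /conjg invgM !mulgA.
    exact: (filt_comm sR u.2 sv).
  apply: (contracts_stable FR Fa).
  have [Q [p [_ p1 pE]]] := filt_quotient FR i.+1.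
  apply/p1; rewrite gmulfM multiplicativeV !gmulfM.
  (* [u.1] is arbitrary here: this is where [v.2] must be in [shifting i] *)
  have -> : p (a v.2 u.1) = p u.1.
    by apply/pE; apply: (sv 0%N); apply: filt0 FR _.
  have -> : p (a u.2 v.1) = p v.1 by apply/pE; apply: Fa.
  have -> : p u.1 * p v.1 = p v.1 * p u.1 * p [~ u.1, v.1].
    by rewrite -!gmulfM -commgC.
  by rewrite mulKg; apply/p1; apply: (filt_comm FR u.1 Fv).
- have := (filt_factor FR i, filt_factor sR i).
  case: (R) => [pi pr|q q2] /= [FF sF] u.
    move=> n Eu pin; have [E2 E1] := sdprod_filtrationX n Eu.
    case: Eu => [Fu su]; rewrite /E /sdprod_filtration /= E2 => -[/E1 Fun sun].
    by split; [apply: FF Fun|apply: sF sun].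
  move=> Eu; have [E2 E1] := sdprod_filtrationX q Eu; case: Eu => Fu su.
  by split; [apply/E1; apply: FF|rewrite E2; apply: sF].
Qed.

End SdprodFiltration.
(** * Commutators in the lower central series *)

Section GammaCommutator.
Variables (R : coef) (H : groupType).

Definition conj_map (h x : H) : H := h * x * h^-1.

Lemma conj_map1 x : conj_map 1 x = x.
Proof. by rewrite /conj_map mul1g invg1 mulg1. Qed.

Lemma conj_mapMl h l x : conj_map (h * l) x = conj_map h (conj_map l x).
Proof. by rewrite /conj_map invgM !mulgA. Qed.

Lemma conj_mapM h : {morph conj_map h : x y / x * y}.
Proof. by move=> x y; rewrite /conj_map !mulgA mulgVK. Qed.

Definition conj_act : groupAct H H := GroupAct conj_map1 conj_mapMl conj_mapM.

(** $[\gamma_i, \gamma_j] \subseteq \gamma_{i+j}$ in the usual indexing. The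
    group [H] acting on itself by conjugation contracts [gammaR], so the
    elements of degree at least [i.+1] for this action are an [R]-filtration of
    [H], which contains [gammaR] by minimality. *)
Lemma gammaR_comm i j (h x : H) :
  gammaR R i h -> gammaR R j x -> gammaR R (j + i).+1 [~ h, x].
Proof.
have gR := gammaR_filtration R H.
have ca n : contracts conj_act (@gammaR R H n) (gammaR R n.+1).
  move=> k y gy.
  have -> : conj_act k y * y^-1 = [~ k^-1, y^-1].
    by rewrite /commg /conjg /= /conj_map !invgK !mulgA.
  apply: (filt_comm gR); exact: subgroupV (filt_sub gR n) gy.
move=> gh gx.
have sh := gammaR_smallest (R_filtration_shifting gR ca) gh.
have -> : [~ h, x] = conj_act h^-1 x^-1 * (x^-1)^-1.
  by rewrite /commg /conjg /= /conj_map !invgK !mulgA.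
apply: (subgroupV (filt_sub (R_filtration_shifting gR ca) i) sh).
exact: subgroupV (filt_sub gR j) gx.
Qed.

End GammaCommutator.

Section CentralCommutators.
Variable G : groupType.
Implicit Types x y z : G.

Lemma commute_conj x y : commute x y -> x ^ y = x.
Proof. by move=> xy; rewrite /conjg xy mulKg. Qed.

Lemma commMg_central x y z :
  commute [~ x, z] y -> [~ x * y, z] = [~ x, z] * [~ y, z].
Proof.
move=> /commute_conj E; rewrite -{1}E /commg /conjg !invgM !mulgA.
by rewrite !(mulgVK, mulgK).
Qed.

Lemma commgM_central x y z :
  commute [~ x, y] z -> [~ x, y * z] = [~ x, z] * [~ x, y].
Proof.
move=> /commute_conj E; rewrite -{1}E /commg /conjg !invgM !mulgA.
by rewrite !(mulgVK, mulgK).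
Qed.

End CentralCommutators.
(** * Unipotence on the factors of the lower central series *)

Section UpperSeries.
Variables (R : coef) (K H : groupType) (a : groupAct K H).

Let g : nat -> set H := @gammaR R H.
Let gR : R_filtration R g := gammaR_filtration R H.

Lemma gammaR_stable i k x : g i x -> g i (a k x).
Proof. exact: gammaR_map. Qed.

(** The preimage in [gammaR R c] of the [i]-th term of the ascending series of
    [K]-fixed points of [gammaR R c / gammaR R c.+1]. *)
Fixpoint upper (c i : nat) : set H :=
  if i is i'.+1 then [set x | g c x /\ forall k, upper c i' (a k x * x^-1)]
  else g c.+1.

Lemma upper_sub_gammaR c i : upper c i `<=` g c.
Proof. by case: i => [|i] x; [apply: filt_dec gR _ _ (leqnSn c) _|case]. Qed.

Lemma gammaR_sub_upper c i : g c.+1 `<=` upper c i.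
Proof.
elim: i => [//|i IHi] x gx; split; first exact: filt_dec gR _ _ (leqnSn c) _ gx.
move=> k; apply: IHi; apply: (subgroupM (filt_sub gR _)).
  exact: gammaR_stable.
exact: subgroupV (filt_sub gR _) gx.
Qed.

Lemma upper_le c i j : (i <= j)%N -> upper c i `<=` upper c j.
Proof.
have upperS n : upper c n `<=` upper c n.+1.
  elim: n => [|n IHn] x; first exact: gammaR_sub_upper.
  by move=> [gx ux]; split=> // k; apply/IHn/ux.
move=> /subnK <-; elim: (j - i)%N => [//|n IHn].
by rewrite addSn; apply: subset_trans (upperS _).
Qed.

Section Displacement.
Variables (c : nat) (Q : groupType) (p : {multiplicative H -> Q}).
Hypothesis p1 : forall x, p x = 1 <-> g c.+1 x.

Lemma gammaR_central x y : g c x -> commute (p x) (p y).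
Proof.
move=> gx; rewrite /commute -!gmulfM commgC gmulfM.
by rewrite (p1 [~ x, y]).2 ?mulg1 //; apply: (filt_comml gR).
Qed.

(** [x |-> k(x) x^-1] is an endomorphism of the abelian group
    [gammaR R c / gammaR R c.+1]; the argument [x] may be arbitrary because
    [gammaR R c] is central modulo [gammaR R c.+1]. *)
Lemma displacementM k x y : g c y ->
  p (a k (x * y) * (x * y)^-1) = p (a k x * x^-1) * p (a k y * y^-1).
Proof.
move=> gy; have gd : g c (a k y * y^-1).
  apply: (subgroupM (filt_sub gR c)); first exact: gammaR_stable.
  exact: subgroupV (filt_sub gR c) gy.
have -> : a k (x * y) * (x * y)^-1 = a k x * (a k y * y^-1) * x^-1.
  by rewrite gactM invgM !mulgA.
rewrite [in LHS]gmulfM [in LHS]gmulfM [p (a k x * x^-1)]gmulfM -!mulgA.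
by rewrite [in LHS](gammaR_central x^-1 gd).
Qed.

Lemma displacementX k x n : g c x ->
  p (a k (x ^+ n) * (x ^+ n)^-1) = p (a k x * x^-1) ^+ n.
Proof.
move=> gx; elim: n => [|n IHn].
  by rewrite multiplicative1 mulgV multiplicative1.
by rewrite !expgSr displacementM // IHn.
Qed.

Lemma displacementV k x : g c x ->
  p (a k x^-1 * (x^-1)^-1) = (p (a k x * x^-1))^-1.
Proof.
move=> gx; apply: (mulgI (p (a k x * x^-1))).
rewrite mulgV -displacementM; last exact: subgroupV (filt_sub gR c) gx.
by rewrite mulgV multiplicative1 mulgV multiplicative1.
Qed.

End Displacement.

Lemma upper_subgroup c i : subgroup (upper c i).
Proof.
have sg := filt_sub gR.
have [Q [p [_ p1 pE]]] := filt_quotient gR c.+1.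
elim: i => [|i IHi]; first exact: sg.
have cong u v : p u = p v -> upper c i v -> upper c i u.
  move=> /pE guv uv; rewrite -[u](divgK v); apply: (subgroupM IHi) => //.
  exact: gammaR_sub_upper.
apply/subgroupP; split=> [|x y [gx ux] [gy uy]].
  by apply: gammaR_sub_upper; apply: subgroup1 (sg _).
have gV : g c y^-1 := subgroupV (sg c) gy.
split=> [|k]; first exact: subgroupM (sg c) gx gV.
apply: (cong _ (a k x * x^-1 * (a k y * y^-1)^-1)).
  rewrite (displacementM p1) // (displacementV p1) //.
  by rewrite -multiplicativeV -gmulfM.
exact: subgroupM IHi (ux k) (subgroupV IHi (uy k)).
Qed.

Lemma upper_mod c i Q (p : {multiplicative H -> Q}) u v :
  (forall x y, p x = p y <-> g c.+1 (x * y^-1)) ->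
  p u = p v -> upper c i v -> upper c i u.
Proof.
move=> pE /pE guv uv; rewrite -[u](divgK v).
by apply: (subgroupM (upper_subgroup c i)) => //; apply: gammaR_sub_upper.
Qed.

Lemma upper_conj c i x h : upper c i x -> upper c i (x ^ h).
Proof.
move=> ux; rewrite -[x ^ h](mulVKg x).
apply: (subgroupM (upper_subgroup c i)) => //.
by apply: gammaR_sub_upper; apply: (filt_comml gR); apply: upper_sub_gammaR ux.
Qed.

(** Over $\mathbb Z[\pi^{-1}]$: if [x ^+ n] is in [upper c i.+1], then the
    displacements of [x] have their [n]-th powers in [upper c i], because
    displacement is a homomorphism; induction on [i]. *)
Lemma upper_factor c i : R_factor R (g c) (upper c i).
Proof.
have [Q [p [_ p1 pE]]] := filt_quotient gR c.+1.
have := filt_factor gR c; case: (R) => [pi pr|q q2] /= FF; last first.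
  by move=> x gx; apply: gammaR_sub_upper; apply: FF.
move=> x n gx pin; elim: i x gx => [|i IHi] x gx; first exact: FF.
case=> _ uxn; split=> // k; apply: IHi.
  apply: (subgroupM (filt_sub gR c)); first exact: gammaR_stable.
  exact: subgroupV (filt_sub gR c) gx.
apply: (upper_mod pE _ (uxn k)).
by rewrite (displacementX p1) // multiplicativeX.
Qed.
(** [K] acts unipotently on the factor of index [c]. *)
Definition exhausted c := exists m, g c `<=` upper c m.

(** The commutator map from [gammaR R c] times [H] to
    [gammaR R c.+1 / gammaR R c.+2] is bilinear and [K]-equivariant. If [k]
    moves [y] to [y' * y] and [x] to [x' * x], it moves [[~ y, x]] by
    [[~ y', x] * [~ y', x'] * [~ y, x']] modulo [gammaR R c.+2], and each factor
    has a smaller index. When [j = 0] the element [x] is in [gammaR R 1], and the commutator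
    vanishes by [gammaR_comm]. *)
Lemma upper_comm c i j y x :
  upper c i y -> upper 0 j x -> upper c.+1 (i + j) [~ y, x].
Proof.
elim: i j y x => [|i IHi] j y x.
  by move=> gy _; apply: gammaR_sub_upper; apply: (filt_comml gR).
elim: j y x => [|j IHj] y x uy ux.
  apply: gammaR_sub_upper.
  exact: (@gammaR_comm R H c 1 y x (upper_sub_gammaR uy) ux).
have [gy uky] := uy; have [_ ukx] := ux.
rewrite addnS; split=> [|k]; first exact: (filt_comml gR).
have [y' kyE] : exists y', a k y = y' * y.
  by exists (a k y * y^-1); rewrite divgK.
have [x' kxE] : exists x', a k x = x' * x.
  by exists (a k x * x^-1); rewrite divgK.
have uy' : upper c i y' by have := uky k; rewrite kyE mulgK.
have ux' : upper 0 j x' by have := ukx k; rewrite kxE mulgK.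
have gy' := upper_sub_gammaR uy'.
have [Q [p [_ p1 pE]]] := filt_quotient gR c.+2.
have cen u v w : g c u -> commute [~ p u, p v] (p w).
  move=> gu; rewrite -multiplicativeR; apply: (gammaR_central p1).
  exact: (filt_comml gR).
apply: (@upper_mod c.+1 _ Q p _ ([~ y', x] * [~ y', x'] * [~ y, x']) pE).
  rewrite [a k [~ y, x]]multiplicativeR /= kyE kxE.
  rewrite [LHS]gmulfM [RHS]gmulfM [p (_ * [~ y', x'])]gmulfM multiplicativeV.
  rewrite !multiplicativeR !gmulfM.
  rewrite commMg_central; last by rewrite -gmulfM; apply: cen.
  rewrite !commgM_central; try exact: cen.
  have comm : commute [~ p y, p x] [~ p y, p x'].
    by rewrite -[[~ p y, p x']]multiplicativeR; apply: cen.
  by rewrite comm mulgA mulgK.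
apply: (subgroupM (upper_subgroup _ _)).
  apply: (subgroupM (upper_subgroup _ _)).
    by rewrite addSn -addnS; apply: IHi.
  by apply: upper_le (IHi _ _ _ uy' ux'); rewrite addSn.
exact: IHj.
Qed.

Section Step.
Variables (c m l : nat).
Hypothesis cm : g c `<=` upper c m.
Hypothesis ul : forall x, upper 0 l x.

Lemma upper_commT y x : g c y -> upper c.+1 (m + l) [~ y, x].
Proof. by move=> gy; apply: upper_comm; [apply: cm|apply: ul]. Qed.

(** Modulo [upper c.+1 (m + l)], which contains the commutators of [gammaR R c]
    with [H], the [q]-th power is multiplicative on [gammaR R c]; hence if [k]
    moves [y] to [y' * y], it moves [y ^+ q] by [y' ^+ q] up to an element of
    that subgroup. *)
Lemma upper_pow q i y : (forall j x, g j x -> g j.+1 (x ^+ q)) ->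
  upper c i y -> upper c.+1 (m + l + i) (y ^+ q).
Proof.
move=> gq; elim: i y => [|i IHi] y.
  by move=> gy; apply: gammaR_sub_upper; apply: gq.
move=> [gy uy]; rewrite addnS; split=> [|k]; first exact: gq.
set M := (m + l)%N in IHi *.
have [y' kyE] : exists y', a k y = y' * y.
  by exists (a k y * y^-1); rewrite divgK.
have uy' : upper c i y' by have := uy k; rewrite kyE mulgK.
have [Q [p [_ p1 pE]]] :=
  exists_quotient (upper_subgroup c.+1 M) (@upper_conj c.+1 M).
have cyy : commute (p y') (p y).
  rewrite /commute -!gmulfM commgC gmulfM (p1 [~ y', y]).2 ?mulg1 //.
  exact: upper_commT (upper_sub_gammaR uy').
have : p (a k (y ^+ q) * (y ^+ q)^-1) = p (y' ^+ q).
  rewrite [a k (y ^+ q)]multiplicativeX /= kyE gmulfM multiplicativeV.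
  by rewrite !multiplicativeX gmulfM expgMn // mulgK.
move/pE => uM; rewrite -[X in upper _ _ X](divgK (y' ^+ q)).
apply: (subgroupM (upper_subgroup _ _)); last exact: IHi.
by apply: upper_le uM; rewrite leq_addr.
Qed.

(** The filtration [F] obtained from [gammaR] by replacing the term of index
    [c.+1] by some [upper c.+1 s] is again an [R]-filtration: the choice of [s]
    makes the new factor of index [c] satisfy the condition of [R]. So [F]
    contains [gammaR]. *)
Lemma exhausted_step : exhausted c.+1.
Proof.
have [s [ms sF]] : exists s, (m + l <= s)%N /\ R_factor R (g c) (upper c.+1 s).
  have gF := filt_factor gR.
  exists (m + l + m)%N; split; first exact: leq_addr.
  have := upper_factor c.+1 (m + l + m).
  case: (R) gF => [pi pr|q q2] /= gF uF x.
    move=> n gx pin uxn; apply: (uF _ n) => //; apply: (gF c x n) => //.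
    exact: upper_sub_gammaR uxn.
  move=> gx; apply: upper_pow => //; exact: cm.
exists s.
pose F i := if i == c.+1 then upper c.+1 s else g i.
have Fg i : F i `<=` g i.
  by rewrite /F; case: eqP => [->|_] x; first exact: upper_sub_gammaR.
have gF i : g i.+1 `<=` F i.
  rewrite /F; case: eqP => [->|_]; first exact: gammaR_sub_upper.
  exact: filt_dec gR _ _ (leqnSn i).
have FR : R_filtration R F.
  apply/R_filtrationP; split=> [|i|i x|i x y Fy|i].
  - by apply/seteqP; split=> // x _; apply: filt0 gR _.
  - by rewrite /F; case: eqP => _; [apply: upper_subgroup|apply: (filt_sub gR)].
  - rewrite {1}/F; case: eqP => [[->]|_]; last exact: gF.
    move=> /upper_sub_gammaR gx; rewrite /F ltn_eqF //.
    exact: filt_dec gR _ _ (leqnSn c) _ gx.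
  - have gy := Fg _ _ Fy.
    rewrite /F; case: eqP => [[ic]|_]; last exact: (filt_comm gR).
    rewrite -invgR; apply: (subgroupV (upper_subgroup _ _)).
    by apply: upper_le ms _ _; apply: upper_commT; rewrite -ic.
  - rewrite {2}/F; case: eqP => [[->]|_].
      by rewrite /F ltn_eqF.
    have := filt_factor gR i; have FGi := Fg i.
    case: (R) => [pi pr|q q2] /= gFi x.
      by move=> n /FGi; apply: gFi.
    by move=> /FGi; apply: gFi.
move=> x gx; have := gammaR_smallest FR gx.
by rewrite /F eqxx.
Qed.
End Step.

End UpperSeries.
(** * The kernel of the map to the base change *)

Section TensorKernel.
Local Open Scope ring_scope.
Variables (A B : zmodType).

Lemma tens_eq0_ind (P : {freeg (A * B)%type / int} -> Prop) u b :
  P 0 -> (forall x y, P x -> P y -> P (x - y)) ->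
  (forall r, @tensor_relations A B r -> P r) ->
  tens u b = 0 -> P << (u, b) >>.
Proof.
move=> P0 PB Pr; rewrite -(raddf0 (@to_tensor A B)) => /to_tensorP.
rewrite subr0 => /asboolP /(_ (fun x => `[< P x >])) H.
apply/asboolP; apply: H => [|r /Pr ?]; last exact/asboolP.
split=> [|x y /asboolP Px /asboolP Py]; apply/asboolP => //; exact: PB.
Qed.

Definition freeg_eval (f : A * B -> A) : {freeg (A * B)%type / int} -> A :=
  fglift (f : A * B -> zmodule A).

Lemma freeg_evalB f x y :
  freeg_eval f (x - y) = freeg_eval f x - freeg_eval f y.
Proof. exact: (lift_is_additive (f : A * B -> zmodule A)). Qed.

Lemma freeg_evalU f z : freeg_eval f << z >> = f z.
Proof. by rewrite /freeg_eval liftU scale1r. Qed.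

Lemma freeg_eval0 f : freeg_eval f 0 = 0.
Proof.
by rewrite -(subrr (0 : {freeg (A * B)%type / int})) freeg_evalB subrr.
Qed.

End TensorKernel.

Section CoefficientKernel.
Local Open Scope ring_scope.

(** For a [pi]-number [N], the rule sending [v] tensor [b] to [(N b) v] makes
    sense in [A] only when [N b] is an integer, and is then biadditive. So a
    given relation of the tensor product is respected by this rule for all
    sufficiently divisible [N], and [u] tensor [1] being zero gives [N u = 0].
    Evaluating the free group in this way avoids constructing the localization
    of [A]. *)
Lemma tens_Zinv_eq0 (A : zmodType) (pi : nat_pred) (u : A) :
  tens u (1%R : Zinv pi) = 0%R ->
  exists n, pi.-nat n /\ (u *+ n = 0)%R.
Proof.
(* [numq] has a meaningful value only when [N * z.2] is an integer *)
pose f (N : nat) (z : A * Zinv pi) : A := (z.1 *~ numq (N%:R * val z.2))%R.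
pose P y := exists n, pi.-nat n /\
  forall N, pi.-nat N -> (n %| N)%N -> (freeg_eval (f N) y = 0)%R.
move=> u0; have : P << (u, 1%R : Zinv pi) >>%R; last first.
  move=> [n [pin /(_ n pin (dvdnn n))]].
  rewrite freeg_evalU /f => E; exists n; split=> //; rewrite -[RHS]E.
  rewrite [val _](erefl : val (1 : Zinv pi) = 1) mulr1.
  by rewrite -[n%:R]/(n%:~R) numq_int.
apply: tens_eq0_ind u0.
- by exists 1%N; split=> // N _ _; apply: freeg_eval0.
- move=> x y [n [pin Pn]] [m [pim Pm]]; exists (n * m)%N; split.
    by rewrite pnatM pin.
  move=> N piN dN; rewrite freeg_evalB Pn ?Pm ?subrr //.
    exact: dvdn_trans (dvdn_mull _ (dvdnn _)) dN.
  exact: dvdn_trans (dvdn_mulr _ (dvdnn _)) dN.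
- move=> _ [[v [v' [b ->]]]|[v [b [b' ->]]]].
    exists 1%N; split=> // N _ _; rewrite !freeg_evalB !freeg_evalU /f /=.
    by rewrite mulrzDl -addrA -opprD subrr.
  exists (`|denq (val b)| * `|denq (val b')|)%N; split.
    by rewrite pnatM; apply/andP; split; [apply: (valP b)|apply: (valP b')].
  have clear_den (x : rat) N : (`|denq x| %| N)%N ->
      (N%:R * x = (numq (N%:R * x))%:~R)%R.
    move=> /dvdnP[k ->].
    have -> : (k * `|denq x|)%N%:R * x = (k%:Z * numq x)%:~R.
      by rewrite intrM numqE -[in RHS]absz_denq -!pmulrn natrM mulrA mulrAC.
    by rewrite numq_int.
  move=> N piN dN; rewrite !freeg_evalB !freeg_evalU /f /=.
  have E : (numq (N%:R * (val b + val b')) =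
      numq (N%:R * val b) + numq (N%:R * val b'))%R.
    rewrite mulrDr.
    rewrite (clear_den (val b)); last first.
      exact: dvdn_trans (dvdn_mulr _ (dvdnn _)) dN.
    rewrite (clear_den (val b')); last first.
      exact: dvdn_trans (dvdn_mull _ (dvdnn _)) dN.
    by rewrite -intrD !numq_int.
  by rewrite E mulrzDr -addrA -opprD subrr.
Qed.

(** Evaluation of [v] tensor [b] as a multiple of [v] by the representative of
    [b] in [0, q) respects the relations modulo [q A]. *)
Lemma tens_Zmod_eq0 (A : zmodType) (q : nat) (u : A) : (2 <= q)%N ->
  tens u (1%R : 'Z_q) = 0%R -> exists v, (u = v *+ q)%R.
Proof.
move=> q2; pose f (z : A * 'Z_q) : A := (z.1 *+ (z.2 : 'Z_q))%R.
pose P y := exists v, (freeg_eval f y = v *+ q)%R.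
move=> u0; have : P << (u, 1%R : 'Z_q) >>%R; last first.
  by move=> [v]; rewrite freeg_evalU /f /= modn_small // mulr1n => ->; exists v.
apply: tens_eq0_ind u0.
- by exists 0%R; rewrite freeg_eval0 mul0rn.
- move=> x y [v vE] [w wE]; exists (v - w)%R.
  by rewrite freeg_evalB vE wE mulrnBl.
- move=> _ [[v [v' [b ->]]]|[v [b [b' ->]]]].
    exists 0%R; rewrite !freeg_evalB !freeg_evalU /f /=.
    by rewrite mulrnDl mul0rn -addrA -opprD subrr.
  have modE (k : nat) : (k %% (Zp_trunc q).+2 = k %% q)%N by rewrite Zp_cast.
  rewrite /P !freeg_evalB !freeg_evalU /f /= modE.
  exists (- (v *+ ((b + b') %/ q))).
  rewrite mulNrn -mulrnA -addrA -opprD -mulrnDr {2}(divn_eq (b + b') q).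
  by rewrite mulrnDr opprD addrCA subrr addr0.
Qed.

End CoefficientKernel.
Lemma derived_sub_gammaR (R : coef) (H : groupType) :
  @derived_subgroup H `<=` gammaR R 1.
Proof.
have gR := gammaR_filtration R H.
apply: generated_sub; first exact: filt_sub gR 1%N.
by move=> _ [x _ [y _ ->]]; apply: (filt_comm gR); apply: filt0 gR y.
Qed.

Lemma to_abX (H : groupType) (x : H) n : to_ab (x ^+ n) = (to_ab x *+ n)%R.
Proof. by elim: n => [//|n IHn]; rewrite expgS to_abM IHn mulrS. Qed.

Lemma tens1_eq0_gammaR (R : coef) (H : groupType) (x : H) :
  tens (to_ab x) (1%R : R) = 0%R -> gammaR R 1 x.
Proof.
have gR := gammaR_filtration R H.
have dg := @derived_sub_gammaR R H.
case: R gR dg => [pi pr|q q2] gR dg /=.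
  move=> /tens_Zinv_eq0[n [pin]]; rewrite -to_abX => /esym/to_abP.
  rewrite invg1 mul1g => /dg gxn.
  exact: (filt_factor gR 0 x n (filt0 gR x) pin gxn).
move=> /(tens_Zmod_eq0 q2)[v]; have [y ->] := to_ab_surj v.
rewrite -to_abX => /esym/to_abP/dg gyx.
rewrite -[x](mulVKg (y ^+ q)); apply: (subgroupM (filt_sub gR 1)) => //.
exact: (filt_factor gR 0 y (filt0 gR y)).
Qed.

(** * Refining the lower central series *)

Section Refinement.
Variables (R : coef) (K H : groupType) (a : groupAct K H).

(** The term [upper 0 j] contains the preimage of the [j]-th term from the end
    of the unipotent filtration of $H^{ab} \otimes R$. *)
Lemma unipotent_exhausted :
  unipotent (ab_linAct a R) -> exists l, forall x, upper R a 0 l x.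
Proof.
move=> [l [W [W0 Wl _ _ WS]]]; exists l => x.
suff W_upper j y : (j <= l)%N -> W (l - j)%N (tens (to_ab y) (1%R : R)) ->
    upper R a 0 j y.
  by apply: W_upper; rewrite ?subnn ?W0.
elim: j y => [|j IHj] y jl.
  by rewrite subn0 Wl => /tens1_eq0_gammaR.
move=> Wy; split=> [|k]; first exact: filt0 (gammaR_filtration R H) y.
apply: IHj; first exact: ltnW.
have [] := WS (l - j.+1)%N; first by rewrite ltn_subrL (leq_ltn_trans _ jl).
rewrite subnSK // => _ /(_ k _ Wy).
rewrite [ab_linAct a R k _]ab_actE -{1}[a k y](divgK y) to_abM tensDl.
by rewrite addrK.
Qed.

(** [M] begins a descending series, contracted by [K], that reaches
    [gammaR R n]: all that is required of an [R]-filtration except that it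
    begins with [H], so that such series can be prolonged upwards. *)
Definition contracting_series (n : nat) (M : set H) : Prop :=
  exists (F : nat -> set H) (m : nat),
    [/\ F 0%N = M, F m `<=` gammaR R n,
        forall i, subgroup (F i) /\ F i.+1 `<=` F i,
        forall i x y, F i y -> F i.+1 [~ x, y] &
        forall i, contracts a (F i) (F i.+1) /\ R_factor R (F i) (F i.+1)].

Lemma contracting_series_cons n M N :
  contracting_series n N -> subgroup M -> N `<=` M ->
  (forall x y, M y -> N [~ x, y]) -> contracts a M N -> R_factor R M N ->
  contracting_series n M.
Proof.
move=> [F [m [F0 Fm sF cF aF]]] sM NM cM aM RM.
exists (fun i => if i is i'.+1 then F i' else M), m.+1.
split=> // -[|i] /=; rewrite ?F0 //; exact: cF.
Qed.

Hypothesis uni : unipotent (ab_linAct a R).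

Lemma all_exhausted c : exhausted R a c.
Proof.
have [l ul] := unipotent_exhausted uni.
elim: c => [|c [m cm]]; first by exists l => x _.
exact: exhausted_step cm ul.
Qed.

Let gR := gammaR_filtration R H.

Lemma contracting_series_upper n c :
  contracting_series n (gammaR R c.+1) -> contracting_series n (@gammaR R H c).
Proof.
move=> sc; have [m um] := all_exhausted c.
have <- : upper R a c m = gammaR R c.
  by apply/seteqP; split=> //; apply: upper_sub_gammaR.
elim: m {um} => [//|m IHm]; apply: contracting_series_cons IHm _ _ _ _ _.
- exact: upper_subgroup.
- exact: upper_le.
- move=> x y uy; apply: gammaR_sub_upper; apply: (filt_comm gR).
  exact: upper_sub_gammaR uy.
- by move=> k x [_]; apply.
- have ug := @upper_sub_gammaR R K H a c m.+1.
  have := upper_factor R a c m; case: (R) ug => [pi pr|q q2] /= ug uF x.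
    by move=> n' /ug; apply: uF.
  by move=> /ug; apply: uF.
Qed.

Lemma contracting_series_gammaR n c :
  (c <= n)%N -> contracting_series n (@gammaR R H c).
Proof.
move=> /subnK <-; move: (n - c)%N => d; elim: d c => [|d IHd] c; last first.
  by apply: contracting_series_upper; rewrite addSnnS; apply: IHd.
exists (fun=> gammaR R c), 0%N; split=> //.
- by move=> i; split=> //; apply: filt_sub gR c.
- by move=> _ x y gy; apply: filt_dec gR _ _ (leqnSn c) _ (filt_comm gR x gy).
- move=> _; split=> [k x gx|].
    apply: (subgroupM (filt_sub gR c)); first exact: gammaR_stable.
    exact: subgroupV (filt_sub gR c) gx.
  have := filt_sub gR c; case: (R) => [pi pr|q q2] /= sg x //.
  exact: subgroupX.
Qed.

Lemma contracting_R_filtration n : exists (F : nat -> set H) (m : nat),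
  [/\ R_filtration R F, forall i, contracts a (F i) (F i.+1) &
      F m `<=` gammaR R n].
Proof.
have [F [m [F0 Fm sF cF aF]]] := contracting_series_gammaR (leq0n n).
exists F, m; split=> //; last by move=> i; have [] := aF i.
apply/R_filtrationP; split=> //.
- by rewrite F0; apply/seteqP; split=> // x _; apply: filt0 gR x.
- by move=> i; have [] := sF i.
- by move=> i; have [] := sF i.
- by move=> i; have [] := aF i.
Qed.

End Refinement.

Theorem theorem7p55 (R : coef) (K H : groupType) (a : groupAct K H) :
  residually (classR R) H ->
  residually (classR R) K ->
  unipotent (ab_linAct a R) ->
  residually (classR R) (sdprod a).
Proof.
move=> resH resK uni [x k]; have [-> x1|k1 _] := pselect (k = 1).
  have {}x1 : x <> 1 by move=> xE; apply: x1; rewrite xE.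
  have [Q [psi [[n gQ] _ psix]]] := resH x x1.
  have [F [m [FR Fa Fm]]] := contracting_R_filtration uni n.
  apply: (R_filtration_quotient (n := m) (R_filtration_sdprod FR Fa)).
  case=> /= Fx _.
  by apply: psix; have := gammaR_map psi (Fm _ Fx); rewrite gQ.
have [Q [psi [RQ psiT psik]]] := resK k k1.
pose f (u : sdprod a) : Q := psi u.2.
have fM : {morph f : u v / u * v} by move=> u v; rewrite /f gmulfM.
pose fm := HB.pack_for {multiplicative sdprod a -> Q} f
  (isMultiplicative.Build _ _ f fM).
exists Q, fm; split=> //; apply/seteqP; split=> // u _.
have : setT u by []; rewrite -psiT => -[l _ <-].
by exists (1, l).
Qed.
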